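(* Let $M=(\mathcal S,\mathcal A,P,r)$ be a weakly communicating MDP with finite state and action sets and rewards in $[0,1]$, and let $H:=sp(h^* )$ be the span of the bias of a gain-optimal policy, with $H\ge 1$. For any $\varepsilon\in(0,1]$, take $\gamma=1-\frac{\varepsilon}{H}$. Then for any $\varepsilon_\gamma\in[0,\frac{1}{1-\gamma}]$ and any stationary policy $\pi$ that is $\varepsilon_\gamma$-optimal in the discounted MDP $(M,\gamma)$, i.e. $\|V_\gamma^*-V_\gamma^\pi\|_\infty\le\varepsilon_\gamma$, it holds (at every state) that \[ \rho^*-\rho^\pi\le 8\varepsilon+3(1-\gamma)\varepsilon_\gamma=\Bigl(8+3\frac{\varepsilon_\gamma}{H}\Bigr)\varepsilon. \]
   Context: An MDP is a tuple $M=(\mathcal S,\mathcal A,P,r)$ with finite state set $\mathcal S$, finite action set $\mathcal A$, transition probabilities $P(s'\mid s,a)$ and reward $r:\mathcal S\times\mathcal A\to[0,1]$. A stationary policy $\pi$ assigns to each state $s$ a probability distribution $\pi(\cdot\mid s)$ on $\mathcal A$; it induces trajectories with $a_t\sim\pi(\cdot\mid s_t)$, $r_t=r(s_t,a_t)$, $s_{t+1}\sim P(\cdot\mid s_t,a_t)$. Values: $V_\gamma^\pi(s):=\mathbb E^\pi[\sum_{t\ge0}\gamma^t r_t\mid s_0=s]$ for a discount factor $\gamma\in[0,1)$ (with $0^0=1$), and $V_\gamma^*:=\max_\pi V_\gamma^\pi$ (maximum over all history-dependent policies, for all states simultaneously; attained by a stationary policy). $V_T^\pi(s):=\mathbb E^\pi[\sum_{t=0}^{T-1}r_t\mid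 s_0=s]$; gain $\rho^\pi(s):=\lim_{T\to\infty}\frac1T V_T^\pi(s)$; bias $h^\pi(s):=\mathrm{C}\text{-}\lim_{T\to\infty}[V_T^\pi(s)-T\rho^\pi(s)]$ (Cesàro limit). The optimal gain is $\rho^*:=\max_\pi\rho^\pi$ (over all history-dependent policies). $M$ is weakly communicating if, apart from a (possibly empty) set of states that are transient in the Markov chain induced by every policy, for any two other states $s_1,s_2$ there is a policy to go from $s_1$ to $s_2$. In this case $\rho^*$ is a constant vector. The optimal bias is $h^*:=h^{\pi^*}$, where $\pi^*$ is a stationary gain-optimal policy, i.e. $\rho^{\pi^*}=\rho^*$; no further condition is placed on $\pi^*$ (the quantity $H=sp(h^* )$ is described as the span of the bias of any optimal policy). The span of a vector $x$ is $sp(x):=\max_i x_i-\min_i x_i$. *)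

(* Defs.v *)
From HB Require Import structures.
From mathcomp Require Import all_boot all_order all_algebra.
From mathcomp Require Import all_classical all_reals all_analysis.
Set Implicit Arguments.
Unset Strict Implicit.
Unset Printing Implicit Defensive.
Import Order.TTheory GRing.Theory Num.Theory.
Import numFieldNormedType.Exports.
Local Open Scope classical_set_scope.
Local Open Scope ring_scope.

Record distr (R : realType) (T : finType) := Distr {
  distr_fun :> T -> R;
  distr_ge0 : forall x, 0 <= distr_fun x;
  distr_sum1 : \sum_x distr_fun x = 1 }.

Record mdp (R : realType) (S A : finType) := MDP {
  trans : S -> A -> distr R S;
  reward : S -> A -> R;
  reward_bounds : forall s a, 0 <= reward s a <= 1 }.

Section MDP.
Context {R : realType} {S A : finType}.
Implicit Types (M : mdp R S A) (s : S).

Definition stationary_policy := S -> distr R A.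

(* The first argument is the past [:: (s_0, a_0); ..; (s_(t-1), a_(t-1))], the
   second one is the current state s_t. *)
Definition policy := seq (S * A) -> S -> distr R A.

Definition policy_of (pi : stationary_policy) : policy := fun _ s => pi s.

(* Probability that, after the given past and with the next state drawn from
   mu, the next size w state-action pairs are those listed in w. *)
Fixpoint traj_prob_from M (pi : policy) (past : seq (S * A)) (mu : S -> R)
    (w : seq (S * A)) : R :=
  match w with
  | [::] => 1
  | (s, a) :: w' =>
      mu s * pi past s a
      * traj_prob_from M pi (rcons past (s, a)) (trans M s a) w'
  end.

Definition traj_prob M pi s (w : seq (S * A)) : R :=
  traj_prob_from M pi [::] (fun s' => (s' == s)%:R) w.

(* E^pi[f((s_0, a_0), .., (s_(T-1), a_(T-1))) | s_0 = s] *)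
Definition expect M pi s (T : nat) (f : T.-tuple (S * A) -> R) : R :=
  \sum_(w : T.-tuple (S * A)) traj_prob M pi s w * f w.

Definition value M pi (T : nat) s : R :=
  expect M pi s (fun w : T.-tuple (S * A) =>
    \sum_(t < T) reward M (tnth w t).1 (tnth w t).2).

(* The rewards are bounded, so the expectation of the infinite discounted sum
   is the limit of the expectations of its partial sums. *)
Definition disc_value M pi (gamma : R) s : R :=
  limn (fun T => expect M pi s (fun w : T.-tuple (S * A) =>
    \sum_(t < T) gamma ^+ t * reward M (tnth w t).1 (tnth w t).2)).

(* Here and in opt_gain the supremum is a maximum, attained at all states
   simultaneously by a stationary policy. *)
Definition opt_disc_value M (gamma : R) s : R :=
  sup (range (fun pi : policy => disc_value M pi gamma s)).

Definition gain M (pi : stationary_policy) s : R :=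
  limn (fun T => T%:R^-1 * value M (policy_of pi) T s).

(* The averages (1/T) V_T^pi need not converge when pi is history-dependent,
   hence the limit inferior; for stationary policies it is the gain. *)
Definition lower_gain M (pi : policy) s : R :=
  limn_inf (fun T => T%:R^-1 * value M pi T s).

Definition opt_gain M s : R :=
  sup (range (fun pi : policy => lower_gain M pi s)).

Definition gain_optimal M (pi : stationary_policy) : Prop :=
  forall s, gain M pi s = opt_gain M s.

Definition bias M (pi : stationary_policy) s : R :=
  limn (arithmetic_mean
    (fun T => value M (policy_of pi) T s - T%:R * gain M pi s)).

Definition sp (x : S -> R) : R := sup (range x) - inf (range x).

Definition sup_norm (x : S -> R) : R := \big[Num.max/0]_s `|x s|.

(* Probability that s_t = s for some 1 <= t <= n, starting from s_0 = s, in the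
   limit of n going to infinity. *)
Definition return_prob M (pi : stationary_policy) s : R :=
  limn (fun n => expect M (policy_of pi) s (fun w : n.+1.-tuple (S * A) =>
    (s \in [seq p.1 | p <- behead w])%:R)).

Definition transient M (pi : stationary_policy) s : Prop :=
  return_prob M pi s < 1.

(* The policy pi goes from s1 to s2: it visits s2 with positive probability. *)
Definition leads_to M (pi : policy) s1 s2 : Prop :=
  exists n, 0 < expect M pi s1 (fun w : n.-tuple (S * A) =>
    (s2 \in [seq p.1 | p <- w])%:R).

Definition weakly_communicating M : Prop :=
  exists N : {set S},
    (forall s, s \in N -> forall pi : stationary_policy, transient M pi s) /\
    (forall s1 s2, s1 \notin N -> s2 \notin N ->
       exists pi : policy, leads_to M pi s1 s2).

Definition disc_optimal_within M (gamma eps : R) (pi : stationary_policy)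
    : Prop :=
  sup_norm (fun s => opt_disc_value M gamma s
                     - disc_value M (policy_of pi) gamma s) <= eps.

End MDP.
Arguments stationary_policy : clear implicits.
Arguments policy : clear implicits.

(* Main.v *)
(* If [h] is the bias of a gain-optimal stationary policy and [rho] its gain,
   then [rho + h = r + P h] gives [(1 - gamma) V >= rho - (1 - gamma) sp h] for its
   discounted value [V]. Hence any policy [pi] that is [eps_gamma]-optimal for
   the discount factor [gamma] has [(1 - gamma) V^pi >= c] everywhere, where
   [c = rho - eps - (1 - gamma) eps_gamma]. Averaging
   [r = (1 - gamma) V^pi + gamma (V^pi - P V^pi)] along the chain of [pi] yields
   [rho^pi >= c], which is better than the claimed bound.
   That [rho] is constant holds because the states minimizing it are closed
   under every action, those maximizing it are closed under the optimal policy,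
   and a nonempty closed set contains a state that is not transient. *)
From HB Require Import structures.
Require Import Defs.
From mathcomp Require Import all_boot all_order all_algebra.
From mathcomp Require Import all_classical all_reals all_analysis.
From mathcomp Require Import ring lra.
Set Implicit Arguments.
Unset Strict Implicit.
Unset Printing Implicit Defensive.
Import Order.TTheory GRing.Theory Num.Theory.
Import numFieldNormedType.Exports.
Local Open Scope ring_scope.

(** * Averages under a stochastic kernel and the mean ergodic decomposition *)

Section Kernel.
Local Open Scope classical_set_scope.
Context {R : realType} {S : finType}.
Implicit Types (p : S -> distr R S) (f g : S -> R).

Definition avg p f s : R := \sum_s' p s s' * f s'.

Lemma eq_avg p f g : f =1 g -> avg p f =1 avg p g.
Proof. by move=> fg s; apply: eq_bigr => s' _; rewrite fg. Qed.

Lemma avgD p f g s : avg p (fun x => f x + g x) s = avg p f s + avg p g s.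
Proof. by rewrite -big_split; apply: eq_bigr => s' _; rewrite mulrDr. Qed.

Lemma avgZ p c f s : avg p (fun x => c * f x) s = c * avg p f s.
Proof. by rewrite /avg mulr_sumr; apply: eq_bigr => s' _; rewrite mulrCA. Qed.

Lemma avgN p f s : avg p (fun x => - f x) s = - avg p f s.
Proof. by rewrite -sumrN; apply: eq_bigr => s' _; rewrite mulrN. Qed.

Lemma avgB p f g s : avg p (fun x => f x - g x) s = avg p f s - avg p g s.
Proof. by rewrite avgD avgN. Qed.

Lemma avg_cst p c s : avg p (fun=> c) s = c.
Proof. by rewrite /avg -mulr_suml distr_sum1 mul1r. Qed.

Lemma ler_avg p f g s : (forall x, f x <= g x) -> avg p f s <= avg p g s.
Proof. by move=> fg; apply: ler_sum => s' _; rewrite ler_wpM2l ?distr_ge0. Qed.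

Lemma avg_ge0 p f s : (forall x, 0 <= f x) -> 0 <= avg p f s.
Proof. by move=> f0; rewrite -[0](avg_cst p 0 s); apply: ler_avg. Qed.

Lemma avg_norm_le p f C s : (forall x, `|f x| <= C) -> `|avg p f s| <= C.
Proof.
move=> fC; have fb x : - C <= f x <= C by rewrite -ler_norml.
rewrite ler_norml -{1}(avg_cst p (- C) s) -{2}(avg_cst p C s).
by apply/andP; split; apply: ler_avg => x; case/andP: (fb x).
Qed.

Lemma iter_avg_norm_le p f C t s :
  (forall x, `|f x| <= C) -> `|iter t (avg p) f s| <= C.
Proof. by move=> fC; elim: t s => // t IH s; exact: avg_norm_le. Qed.

Lemma ler_sum_norm f s : `|f s| <= \sum_x `|f x|.
Proof. by rewrite (bigD1 s) //= lerDl sumr_ge0. Qed.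

(** The operator [1 - P], on finite functions because these form a finite-dimensional space, where
    kernel and image have dimensions. *)
Definition drift p (f : {ffun S -> R^o}) : {ffun S -> R^o} :=
  [ffun s => f s - avg p f s].

Fact drift_is_linear p : linear (drift p).
Proof.
move=> c f g; apply/ffunP => s; rewrite !ffunE /=.
under eq_avg => x do rewrite !ffunE.
by rewrite avgD avgZ /GRing.scale /=; ring.
Qed.
HB.instance Definition _ p :=
  GRing.isLinear.Build R {ffun S -> R^o} {ffun S -> R^o} *:%R (drift p)
    (drift_is_linear p).

(* The powers of a kernel are bounded, so [f - P f = y] with [P y = y] forces
   [t y = f - P^t f] to be bounded in [t]: the kernel and the image of [1 - P]
   meet trivially and hence span the whole space. *)
Lemma mean_ergodic p f : exists y z : S -> R,
  avg p y =1 y /\ forall s, f s = y s + z s - avg p z s.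
Proof.
pose L := linfun (drift p).
have LE (g : {ffun S -> R^o}) s : L g s = g s - avg p g s.
  by rewrite lfunE /= ffunE.
have kerP (g : {ffun S -> R^o}) : g \in lker L -> avg p g =1 g.
  rewrite memv_ker => /eqP Lg s; apply/eqP; rewrite eq_sym -subr_eq0 -LE Lg.
  by rewrite ffunE.
have disj : (lker L :&: limg L = 0)%VS.
  apply/eqP; rewrite -subv0; apply/subvP => y.
  rewrite memv_cap => /andP[/kerP yP /memv_imgP[z _ yz]].
  rewrite memv0; apply/eqP/ffunP => s; rewrite ffunE.
  have iterz t : iter t (avg p) z s = z s - t%:R * y s.
    elim: t s => [|t IH] s; first by rewrite mul0r subr0.
    rewrite iterS (eq_avg p IH) avgB avgZ yP [in RHS]yz LE -natr1.
    by rewrite [in LHS]yz LE; ring.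
  pose C := \sum_x `|z x|.
  have tyC t : t%:R * `|y s| <= C + C.
    rewrite -[t%:R]normr_nat -normrM (_ : _ * _ = z s - iter t (avg p) z s).
      rewrite (le_trans (ler_normB _ _))// lerD ?ler_sum_norm//.
      by apply: iter_avg_norm_le => x; exact: ler_sum_norm.
    by rewrite iterz; ring.
  apply/eqP; rewrite -normr_eq0; apply/eqP/le_anti; rewrite normr_ge0 andbT.
  rewrite leNgt; apply/negP => y0.
  have C0 : 0 <= (C + C) / `|y s| by rewrite divr_ge0 ?addr_ge0 ?sumr_ge0.
  by have := archi_boundP C0; rewrite ltr_pdivrMr// ltNge tyC.
(* Rank-nullity: the sum is direct, so its dimension is that of the whole space. *)
have full : (lker L + limg L = fullv)%VS.
  apply/eqP; rewrite eqEdim subvf dimv_disjoint_sum//.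
  by rewrite -(limg_ker_dim L fullv) capfv leqnn.
have /memv_addP[y yk [_ /memv_imgP[z _ ->]] fyz] :
    [ffun s => f s : R^o] \in (lker L + limg L)%VS.
  by rewrite full memvf.
exists y, z; split; first exact: kerP.
move=> s; have /ffunP/(_ s) := fyz; rewrite !ffunE /= => ->.
by rewrite LE addrA.
Qed.

Lemma cvg_bounded_div (b : nat -> R) C : (forall n, `|b n| <= C) ->
  (fun n => n%:R^-1 * b n) @ \oo --> (0 : R).
Proof.
move=> bC; rewrite -cvg_shiftS /=; apply/norm_cvg0P.
have h0 : (fun n : nat => C * @harmonic R n) @ \oo --> (0 : R).
  by rewrite -[X in _ --> X](mulr0 C); apply: cvgMr; exact: cvg_harmonic.
apply: (squeeze_cvgr _ (cvg_cst 0) h0).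
apply: nearW => n; rewrite normr_ge0 /= normrM [leRHS]mulrC ger0_norm ?invr_ge0//.
by rewrite /harmonic /= ler_wpM2l ?invr_ge0.
Qed.

Lemma cvg_bounded_affine_div (b : nat -> R) C y : (forall n, `|b n| <= C) ->
  (fun n => n%:R^-1 * (n%:R * y + b n)) @ \oo --> (y : R).
Proof.
(* The shift drops index 0, where the convention that the inverse of 0 is 0 makes the quotient 0. *)
move=> bC; rewrite -cvg_shiftS /=.
rewrite (_ : (fun _ => _) = (fun n => y + n.+1%:R^-1 * b n.+1)); last first.
  by apply/funext => n; rewrite mulrDr mulKf ?pnatr_eq0.
have b0 : (fun n => n.+1%:R^-1 * b n.+1) @ \oo --> (0 : R).
  by have := cvg_bounded_div bC; rewrite -cvg_shiftS.
have := cvgD (cvg_cst y) b0; rewrite addr0; exact.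
Qed.

End Kernel.

(** * Rewards accumulated along a Markov chain: average, bias and discounted limit *)

Section RewardProcess.
Local Open Scope classical_set_scope.
Context {R : realType} {S : finType}.
Variable p : S -> distr R S.
Implicit Types (r y z f : S -> R).

Lemma cvg_avg (u : nat -> S -> R) (v : S -> R) s :
  (forall x, (fun n => u n x) @ \oo --> v x) ->
  (fun n => avg p (u n) s) @ \oo --> avg p v s.
Proof.
move=> uv; apply: cvg_big => [|x _]; first exact: add_continuous.
by apply: cvgMr; exact: uv.
Qed.

(** Backward recursion for the expected [g]-discounted reward of the first [n] steps; [g = 1] gives
    the total reward. *)
Fixpoint accum r (g : R) (n : nat) (s : S) : R :=
  if n is m.+1 then r s + g * avg p (accum r g m) s else 0.

(** The invariant part [y] is collected once per step, while [z - P z] telescopes. *)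
Lemma accum_decomp r y z : avg p y =1 y ->
  (forall s, r s = y s + z s - avg p z s) ->
  forall n s, accum r 1 n s = n%:R * y s + (z s - iter n (avg p) z s).
Proof.
move=> yP rE; elim=> [|n IH] s; first by rewrite mul0r add0r subrr.
rewrite /= mul1r (eq_avg p IH) avgD avgZ avgB yP rE -natr1; ring.
Qed.

Lemma cvg_accum_mean r y z : avg p y =1 y ->
  (forall s, r s = y s + z s - avg p z s) ->
  forall s, (fun n => n%:R^-1 * accum r 1 n s) @ \oo --> y s.
Proof.
move=> yP rE s; under eq_fun do rewrite (accum_decomp yP rE).
pose C := \sum_x `|z x|; apply: (@cvg_bounded_affine_div _ _ (C + C)) => n.
rewrite (le_trans (ler_normB _ _))// lerD ?ler_sum_norm//.
by apply: iter_avg_norm_le => x; exact: ler_sum_norm.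
Qed.

Lemma accum_series r n s :
  accum r 1 n s = \sum_(0 <= t < n) iter t (avg p) r s.
Proof.
elim: n s => [|n IH] s; first by rewrite big_nil.
rewrite big_nat_recl//= mul1r (eq_avg p IH); congr (_ + _).
rewrite [LHS]/avg; under [LHS]eq_bigr do rewrite /= mulr_sumr.
by rewrite exchange_big.
Qed.

(* If [r = y + z - P z], the bias is [z - P^* z] with [P^* z] the Cesaro limit
   of [P^t z]; the latter is a fixed point of [P]. *)
Lemma cvg_bias r y z : avg p y =1 y ->
  (forall s, r s = y s + z s - avg p z s) ->
  exists h : S -> R,
    (forall s,
      arithmetic_mean (fun n => accum r 1 n s - n%:R * y s) @ \oo --> h s)
    /\ forall s, y s + h s = r s + avg p h s.
Proof.
move=> yP rE; have [y' [z' [y'P zE]]] := mean_ergodic p z.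
exists (fun s => z s - y' s); split; last first.
  by move=> s; rewrite avgB y'P rE; ring.
(* The term of index [n] of [arithmetic_mean] averages [n + 1] values, so the powers of [P] applied
   to [z] add up to [accum z] over [n + 1] steps. *)
move=> s; rewrite (_ : arithmetic_mean _ =
  (fun n => z s - n.+1%:R^-1 * accum z 1 n.+1 s)).
  apply: cvgB; first exact: cvg_cst.
  have := cvg_accum_mean y'P zE (s:=s); rewrite -cvg_shiftS; exact.
apply/funext => n; rewrite /arithmetic_mean /series /=.
under eq_bigr do rewrite (accum_decomp yP rE) addrAC subrr add0r.
rewrite big_split /= sumr_const_nat subn0 sumrN -accum_series.
by rewrite mulrBr -[z s *+ _]mulr_natl mulKf ?pnatr_eq0.
Qed.

Lemma accum_bounds r g n s : 0 <= g < 1 -> (forall s, 0 <= r s <= 1) ->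
  0 <= accum r g n s <= (1 - g)^-1.
Proof.
move=> /andP[g0 g1] r01; have g1' : 0 < 1 - g by rewrite subr_gt0.
elim: n s => [|n IH] s; first by rewrite lexx invr_ge0 ltW.
rewrite [accum _ _ _ _]/=; have /andP[r0 r1] := r01 s; apply/andP; split.
  by rewrite addr_ge0// mulr_ge0// avg_ge0// => x; case/andP: (IH x).
(* The bound is the fixed point of [x = 1 + g * x], hence preserved by one step of the recursion. *)
rewrite (_ : (1 - g)^-1 = 1 + g * (1 - g)^-1); last by field; rewrite gt_eqF.
rewrite lerD// ler_wpM2l// -[leRHS](avg_cst p _ s).
by apply: ler_avg => x; case/andP: (IH x).
Qed.

Lemma accum_nondecreasing r g s : 0 <= g -> (forall s, 0 <= r s) ->
  {homo (fun n => accum r g n s) : m n / (m <= n)%N >-> m <= n}.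
Proof.
move=> g0 r0; apply/nondecreasing_seqP => n.
elim: n s => [|n IH] s; first by rewrite /= addr_ge0// mulr_ge0// avg_ge0.
by rewrite [leRHS]/= [leLHS]/= lerD2l ler_wpM2l// ler_avg.
Qed.

(** Monotone bounded sequences converge, and the recursion passes to the limit. *)
Lemma cvg_accum_disc r g : 0 <= g < 1 -> (forall s, 0 <= r s <= 1) ->
  exists V : S -> R, (forall s, (fun n => accum r g n s) @ \oo --> V s) /\
    forall s, V s = r s + g * avg p V s.
Proof.
move=> g01 r01; pose V s := limn (fun n => accum r g n s).
have Vc s : (fun n => accum r g n s) @ \oo --> V s.
  apply: nondecreasing_is_cvgn.
    apply: accum_nondecreasing; first by case/andP: g01.
    by move=> x; case/andP: (r01 x).
  by exists (1 - g)^-1 => _ [n _ <-]; case/andP: (accum_bounds n s g01 r01).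
exists V; split=> // s.
have Vc' : (fun n => accum r g n.+1 s) @ \oo --> V s.
  by rewrite (cvg_shiftS (fun n => accum r g n s)); exact: Vc.
apply: (cvg_unique (@Rhausdorff R) Vc') => /=.
apply: cvgD; first exact: cvg_cst.
by apply: cvgMr; apply: cvg_avg.
Qed.

End RewardProcess.

(** * Expectations over finite trajectories of history-dependent policies *)

Lemma big_tuple_cons (V : nmodType) (X : finType) n (F : n.+1.-tuple X -> V) :
  \sum_(w : n.+1.-tuple X) F w
    = \sum_(x : X) \sum_(w : n.-tuple X) F [tuple of x :: w].
Proof.
rewrite pair_big /= (reindex (fun q : X * n.-tuple X => [tuple of q.1 :: q.2])).
  by [].
exists (fun w => (thead w, [tuple of behead w])) => [[x w] _|w _] /=.
  by congr pair; apply/val_inj.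
by rewrite [RHS]tuple_eta; apply/val_inj.
Qed.

Section Trajectories.
Local Open Scope classical_set_scope.
Context {R : realType} {S A : finType}.
Variable M : mdp R S A.
Implicit Types (pol : policy R S A) (pi : stationary_policy R S A).
Implicit Types (past : seq (S * A)) (mu : S -> R) (s : S).

(** Past and initial weights are left free so that induction on the horizon works: one step
    lengthens the past and replaces [mu] by [trans M s a]. *)
Definition expect_from pol past mu n (f : n.-tuple (S * A) -> R) : R :=
  \sum_(w : n.-tuple (S * A)) traj_prob_from M pol past mu w * f w.

Lemma expect_fromE pol s n (f : n.-tuple (S * A) -> R) :
  expect M pol s f = expect_from pol [::] (fun s' => (s' == s)%:R) f.
Proof. by []. Qed.

Lemma eq_expect_from pol past mu n (f g : n.-tuple (S * A) -> R) :
  f =1 g -> expect_from pol past mu f = expect_from pol past mu g.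
Proof. by move=> fg; apply: eq_bigr => w _; rewrite fg. Qed.

Lemma expect_from0 pol past mu (f : 0.-tuple (S * A) -> R) :
  expect_from pol past mu f = f [tuple].
Proof.
rewrite /expect_from (big_pred1 [tuple]) ?mul1r//.
by move=> w; apply/esym/eqP; exact: tuple0.
Qed.

Lemma expect_fromS pol past mu n (f : n.+1.-tuple (S * A) -> R) :
  expect_from pol past mu f = \sum_s mu s * \sum_a pol past s a *
    expect_from pol (rcons past (s, a)) (trans M s a)
      (fun w => f [tuple of (s, a) :: w]).
Proof.
rewrite /expect_from big_tuple_cons.
under [RHS]eq_bigr do rewrite mulr_sumr.
rewrite [RHS]pair_big /=; apply: eq_bigr => -[s a] _ /=.
by rewrite !mulr_sumr; apply: eq_bigr => w _; rewrite !mulrA.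
Qed.

Lemma expect_from_cst pol past (mu : distr R S) n c :
  expect_from pol past mu (fun _ : n.-tuple (S * A) => c) = c.
Proof.
elim: n past mu => [|n IH] past mu; first by rewrite expect_from0.
rewrite expect_fromS -[RHS]mul1r -(distr_sum1 mu) mulr_suml.
apply: eq_bigr => s _; congr (_ * _).
rewrite -[RHS]mul1r -(distr_sum1 (pol past s)) mulr_suml.
by apply: eq_bigr => a _; rewrite IH.
Qed.

Lemma expect_fromD pol past mu n (f g : n.-tuple (S * A) -> R) :
  expect_from pol past mu (fun w => f w + g w)
    = expect_from pol past mu f + expect_from pol past mu g.
Proof. by rewrite -big_split; apply: eq_bigr => w _; rewrite mulrDr. Qed.

Lemma expect_fromZ pol past mu n c (f : n.-tuple (S * A) -> R) :
  expect_from pol past mu (fun w => c * f w) = c * expect_from pol past mu f.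
Proof.
by rewrite /expect_from mulr_sumr; apply: eq_bigr => w _; rewrite mulrCA.
Qed.

Definition disc_sum (g : R) n (w : n.-tuple (S * A)) : R :=
  \sum_(t < n) g ^+ t * reward M (tnth w t).1 (tnth w t).2.

Arguments disc_sum g {n} w.

Lemma disc_sum_cons g n s a (w : n.-tuple (S * A)) :
  disc_sum g [tuple of (s, a) :: w] = reward M s a + g * disc_sum g w.
Proof.
rewrite /disc_sum big_ord_recl expr0 mul1r tnth0 mulr_sumr; congr (_ + _).
by apply: eq_bigr => t _; rewrite tnthS exprS mulrA.
Qed.

Lemma valueE pol n s :
  value M pol n s = expect M pol s (disc_sum 1 : n.-tuple (S * A) -> R).
Proof.
apply: eq_bigr => w _; congr (_ * _).
by apply: eq_bigr => t _; rewrite expr1n mul1r.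
Qed.

Lemma expect_disc_sumS pol past mu g n :
  expect_from pol past mu (disc_sum g : n.+1.-tuple (S * A) -> R)
  = \sum_s mu s * \sum_a pol past s a * (reward M s a + g *
      expect_from pol (rcons past (s, a)) (trans M s a)
        (disc_sum g : n.-tuple (S * A) -> R)).
Proof.
rewrite expect_fromS; apply: eq_bigr => s _; congr (_ * _).
apply: eq_bigr => a _; congr (_ * _).
rewrite (eq_expect_from _ _ _ (disc_sum_cons g s a)).
by rewrite expect_fromD expect_from_cst expect_fromZ.
Qed.

Lemma expect_disc_sum0 pol past mu g :
  expect_from pol past mu (disc_sum g : 0.-tuple (S * A) -> R) = 0.
Proof. by rewrite expect_from0 /disc_sum big_ord0. Qed.

Lemma weighted_le (T : finType) (mu : distr R T) (f : T -> R) c :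
  (forall x, f x <= c) -> \sum_x mu x * f x <= c.
Proof.
move=> fc; rewrite -[leRHS]mul1r -(distr_sum1 mu) mulr_suml.
by apply: ler_sum => x _; rewrite ler_wpM2l ?distr_ge0.
Qed.

Lemma weighted_ge0 (T : finType) (mu : distr R T) (f : T -> R) :
  (forall x, 0 <= f x) -> 0 <= \sum_x mu x * f x.
Proof. by move=> f0; apply: sumr_ge0 => x _; rewrite mulr_ge0 ?distr_ge0. Qed.

Lemma expect_disc_sum_bounds pol past (mu : distr R S) g n : 0 <= g ->
  0 <= expect_from pol past mu (disc_sum g : n.-tuple (S * A) -> R)
    <= \sum_(t < n) g ^+ t.
Proof.
move=> g0; elim: n past mu => [|n IH] past mu.
  by rewrite expect_disc_sum0 big_ord0 lexx.
rewrite expect_disc_sumS big_ord_recl expr0.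
apply/andP; split.
  apply: weighted_ge0 => s; apply: weighted_ge0 => a.
  have /andP[r0 _] := reward_bounds M s a.
  rewrite addr_ge0// mulr_ge0//.
  by case/andP: (IH (rcons past (s, a)) (trans M s a)).
apply: weighted_le => s; apply: weighted_le => a.
have /andP[_ r1] := reward_bounds M s a; rewrite lerD//.
under eq_bigr do rewrite /= /bump /= exprS.
rewrite -mulr_sumr ler_wpM2l//.
by case/andP: (IH (rcons past (s, a)) (trans M s a)).
Qed.

(** Nonnegative rewards make the partial sums monotone; with the geometric bound this gives
    convergence of the limit in [disc_value]. *)
Lemma expect_disc_sum_le pol past (mu : distr R S) g n : 0 <= g ->
  expect_from pol past mu (disc_sum g : n.-tuple (S * A) -> R)
  <= expect_from pol past mu (disc_sum g : n.+1.-tuple (S * A) -> R).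
Proof.
move=> g0; elim: n past mu => [|n IH] past mu.
  rewrite expect_disc_sum0.
  by case/andP: (expect_disc_sum_bounds pol past mu 1 g0).
rewrite [leLHS]expect_disc_sumS [leRHS]expect_disc_sumS.
apply: ler_sum => s _; rewrite ler_wpM2l ?distr_ge0//.
apply: ler_sum => a _; rewrite ler_wpM2l ?distr_ge0//.
by rewrite lerD2l ler_wpM2l.
Qed.

Fact dirac_ge0 (T : finType) (x y : T) : 0 <= (y == x)%:R :> R.
Proof. exact: ler0n. Qed.

Fact dirac_sum1 (T : finType) (x : T) : \sum_y (y == x)%:R = 1 :> R.
Proof. by rewrite (bigD1 x)//= eqxx big1 ?addr0// => y /negPf ->. Qed.

Definition point_mass (T : finType) (x : T) : distr R T :=
  Distr (dirac_ge0 x) (dirac_sum1 x).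

Lemma sum_point_mass (T : finType) (x : T) (f : T -> R) :
  \sum_y (y == x)%:R * f y = f x.
Proof.
rewrite (bigD1 x)//= eqxx mul1r big1 ?addr0// => y /negPf ->.
by rewrite mul0r.
Qed.

Lemma value_bounds pol n s : 0 <= value M pol n s <= n%:R.
Proof.
rewrite valueE expect_fromE.
have := @expect_disc_sum_bounds pol [::] (point_mass s) 1 n ler01.
by under eq_bigr do rewrite expr1n; rewrite sumr_const card_ord.
Qed.

Lemma geometric_le (g : R) n : 0 <= g < 1 -> \sum_(t < n) g ^+ t <= (1 - g)^-1.
Proof.
move=> /andP[g0 g1]; have g1' : 0 < 1 - g by rewrite subr_gt0.
elim: n => [|n IH]; first by rewrite big_ord0 invr_ge0 ltW.
rewrite (_ : (1 - g)^-1 = 1 + g * (1 - g)^-1); last by field; rewrite gt_eqF.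
rewrite big_ord_recl expr0 lerD2l.
under eq_bigr do rewrite /= /bump /= exprS.
by rewrite -mulr_sumr ler_wpM2l.
Qed.

Lemma disc_value_le pol g s : 0 <= g < 1 -> disc_value M pol g s <= (1 - g)^-1.
Proof.
move=> g01; have /andP[g0 _] := g01.
pose u n := expect M pol s (disc_sum g : n.-tuple (S * A) -> R).
have ub n : u n <= (1 - g)^-1.
  apply: le_trans (geometric_le n g01).
  by case/andP: (@expect_disc_sum_bounds pol [::] (point_mass s) g n g0).
apply: limr_le; last by apply: nearW => n; exact: ub.
apply: nondecreasing_is_cvgn.
  apply/nondecreasing_seqP => n.
  exact: (@expect_disc_sum_le pol [::] (point_mass s)).
by exists (1 - g)^-1 => _ [n _ <-]; exact: ub.
Qed.

(** The supremum dominates its set only when that set is bounded, hence the preceding bound. *)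
Lemma disc_value_le_opt pol g s : 0 <= g < 1 ->
  disc_value M pol g s <= opt_disc_value M g s.
Proof.
move=> g01; apply: ub_le_sup; last by exists pol.
by exists (1 - g)^-1 => _ [pol' _ <-]; exact: disc_value_le.
Qed.

Lemma lower_gain_le1 pol s : lower_gain M pol s <= 1.
Proof.
pose u n : R := n%:R^-1 * value M pol n s.
have u0 n : 0 <= u n.
  by rewrite mulr_ge0 ?invr_ge0//; case/andP: (value_bounds pol n s).
have u1 n : u n <= 1.
  case: n => [|n]; first by rewrite /u invr0 mul0r.
  rewrite /u ler_pdivrMl ?ltr0n// mulr1.
  by case/andP: (value_bounds pol n.+1 s).
(* Boundedness is the condition for writing [limn_inf] as the supremum of the tail infima. *)
rewrite /lower_gain limn_infE; last first.
  exists 1; split=> // x x1 n _ /=.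
  by rewrite ger0_norm ?u0// (le_trans (u1 n))// ltW.
apply: ge_sup; first by exists (infs u 0%N); exists 0%N.
move=> _ [n _ <-]; apply: le_trans (u1 n); apply: ge_inf.
  by exists 0 => _ [m _ <-]; exact: u0.
by exists n => /=.
Qed.

Lemma lower_gain_le_opt pol s : lower_gain M pol s <= opt_gain M s.
Proof.
apply: ub_le_sup; last by exists pol.
by exists 1 => _ [pol' _ <-]; exact: lower_gain_le1.
Qed.

End Trajectories.
Arguments disc_sum {R S A} M g {n} w.

(** * Stationary policies as Markov chains: gain and bias equations, one-step deviations, hitting
    probabilities *)

Section Stationary.
Local Open Scope classical_set_scope.
Context {R : realType} {S A : finType}.
Variable M : mdp R S A.
Implicit Types (pi : stationary_policy R S A) (past : seq (S * A)) (s : S).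

Fact policy_kernel_ge0 pi s s' : 0 <= \sum_a pi s a * trans M s a s'.
Proof. by apply: weighted_ge0 => a; exact: distr_ge0. Qed.

Fact policy_kernel_sum1 pi s : \sum_s' \sum_a pi s a * trans M s a s' = 1.
Proof.
rewrite exchange_big -[RHS](distr_sum1 (pi s)); apply: eq_bigr => a _.
by rewrite -mulr_sumr distr_sum1 mulr1.
Qed.

Definition policy_kernel pi s : distr R S :=
  Distr (policy_kernel_ge0 pi s) (policy_kernel_sum1 pi s).

Definition mean_reward pi s : R := \sum_a pi s a * reward M s a.

Lemma mean_reward_bounds pi s : 0 <= mean_reward pi s <= 1.
Proof.
apply/andP; split; [apply: weighted_ge0|apply: weighted_le] => a;
by case/andP: (reward_bounds M s a).
Qed.

Lemma avg_policy_kernel pi f s :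
  avg (policy_kernel pi) f s = \sum_a pi s a * \sum_s' trans M s a s' * f s'.
Proof.
rewrite /avg /=; under eq_bigr do rewrite mulr_suml.
rewrite exchange_big; apply: eq_bigr => a _; rewrite mulr_sumr.
by apply: eq_bigr => s' _; rewrite mulrA.
Qed.

(** Agreement with [pi] is asked only on extensions of [past], so that [first_then] is covered once
    its first action has been played. *)
Lemma expect_disc_sum_stationary (pol : policy R S A) pi past (mu : S -> R) g n :
  (forall past' s, pol (past ++ past') s = pi s) ->
  expect_from M pol past mu (disc_sum M g : n.-tuple (S * A) -> R)
  = \sum_s mu s * accum (policy_kernel pi) (mean_reward pi) g n s.
Proof.
elim: n past mu => [|n IH] past mu polE.
  by rewrite expect_disc_sum0 big1// => s _; rewrite mulr0.
rewrite expect_disc_sumS; apply: eq_bigr => s _; congr (_ * _).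
rewrite /= avg_policy_kernel mulr_sumr -big_split; apply: eq_bigr => a _ /=.
have <- : pol past s = pi s by rewrite -(polE [::]) cats0.
rewrite IH ?mulrDr; first by rewrite mulrCA.
by move=> past' s'; rewrite cat_rcons.
Qed.

Lemma value_stationary pi n s :
  value M (policy_of pi) n s = accum (policy_kernel pi) (mean_reward pi) 1 n s.
Proof.
rewrite valueE expect_fromE (@expect_disc_sum_stationary _ pi)//.
by rewrite sum_point_mass.
Qed.

Lemma disc_value_stationary pi g s :
  disc_value M (policy_of pi) g s
  = limn (fun n => accum (policy_kernel pi) (mean_reward pi) g n s).
Proof.
congr (limn _); apply/funext => n.
rewrite expect_fromE (@expect_disc_sum_stationary _ pi)//.
by rewrite sum_point_mass.
Qed.

Lemma disc_value_fixpoint pi g s : 0 <= g < 1 ->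
  disc_value M (policy_of pi) g s = mean_reward pi s
    + g * avg (policy_kernel pi) (disc_value M (policy_of pi) g) s.
Proof.
move=> g01.
have [V [Vc VE]] := cvg_accum_disc (policy_kernel pi) g01 (mean_reward_bounds pi).
have dV x : disc_value M (policy_of pi) g x = V x.
  by rewrite disc_value_stationary; exact: (cvg_lim (@Rhausdorff R) (Vc x)).
by rewrite (eq_avg _ dV) dV.
Qed.

(** The invariant part in the mean ergodic decomposition of the reward is the limit of the averages,
    that is, the gain. *)
Lemma gain_decomp pi : exists z,
  avg (policy_kernel pi) (gain M pi) =1 gain M pi /\
  forall s, mean_reward pi s = gain M pi s + z s - avg (policy_kernel pi) z s.
Proof.
have [y [z [yP rE]]] := mean_ergodic (policy_kernel pi) (mean_reward pi).
have gy s : gain M pi s = y s.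
  rewrite /gain; under eq_fun do rewrite value_stationary.
  exact: (cvg_lim (@Rhausdorff R) (cvg_accum_mean yP rE (s:=s))).
by exists z; split=> s; rewrite ?(eq_avg _ gy) gy.
Qed.

Lemma avg_gain pi : avg (policy_kernel pi) (gain M pi) =1 gain M pi.
Proof. by have [z []] := gain_decomp pi. Qed.

(** The Poisson equation of the chain, here with the Cesaro bias as its solution. *)
Lemma bias_equation pi s :
  gain M pi s + bias M pi s
  = mean_reward pi s + avg (policy_kernel pi) (bias M pi) s.
Proof.
have [z [gP rE]] := gain_decomp pi; have [h [hc hE]] := cvg_bias gP rE.
have bh x : bias M pi x = h x.
  rewrite /bias (_ : (fun n => _) = fun n =>
    accum (policy_kernel pi) (mean_reward pi) 1 n x - n%:R * gain M pi x).
    exact: (cvg_lim (@Rhausdorff R) (hc x)).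
  by apply/funext => n; rewrite value_stationary.
by rewrite (eq_avg _ bh) bh.
Qed.

Definition first_then (a : A) pi : policy R S A :=
  fun past s => if past is [::] then point_mass a else pi s.

Lemma value_first_then a pi n s : value M (first_then a pi) n.+1 s =
  reward M s a + avg (trans M ^~ a) (value M (policy_of pi) n) s.
Proof.
rewrite valueE expect_fromE expect_disc_sumS sum_point_mass sum_point_mass mul1r.
rewrite (@expect_disc_sum_stationary _ pi)//; congr (_ + _).
by apply: eq_bigr => s' _; rewrite value_stationary.
Qed.

(** A single deviation does not affect long-run averages: playing [a] once and then [pi] has as
    lower gain the expected gain of [pi] at the next state. *)
Lemma avg_gain_le_opt a pi s : avg (trans M ^~ a) (gain M pi) s <= opt_gain M s.
Proof.
have [z [gP rE]] := gain_decomp pi; set c := avg _ _ s.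
apply: le_trans (lower_gain_le_opt M (first_then a pi) s).
rewrite /lower_gain (_ : limn_inf _ = c)//.
pose b n := value M (first_then a pi) n s - n%:R * c.
pose C := \sum_x `|z x|.
have zC t x : `|z x - iter t (avg (policy_kernel pi)) z x| <= C + C.
  rewrite (le_trans (ler_normB _ _))// lerD ?ler_sum_norm//.
  by apply: iter_avg_norm_le => x'; exact: ler_sum_norm.
(* The three terms bound the first reward, the one step in which [c] is not earned, and the averaged
   remainder [z - P^n z]. *)
have bC n : `|b n| <= 1 + `|c| + (C + C).
  rewrite /b; case: n => [|n].
    rewrite mul0r subr0 valueE expect_fromE expect_disc_sum0 normr0.
    by rewrite addr_ge0 ?addr_ge0// sumr_ge0.
  rewrite value_first_then.
  have vE x : value M (policy_of pi) n x = n%:R * gain M pi x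
      + (z x - iter n (avg (policy_kernel pi)) z x).
    by rewrite value_stationary (accum_decomp gP rE).
  rewrite (eq_avg _ vE) avgD avgZ -/c; set d := avg _ _ s.
  rewrite (_ : _ - _ = reward M s a - c + d); last by rewrite -natr1; ring.
  rewrite (le_trans (ler_normD _ _))// lerD//; last exact: avg_norm_le.
  rewrite (le_trans (ler_normB _ _))// lerD//.
  by have /andP[r0 r1] := reward_bounds M s a; rewrite ger0_norm.
have := @cvg_bounded_affine_div _ b _ c bC.
rewrite (_ : (fun n => _) = fun n => n%:R^-1 * value M (first_then a pi) n s).
  by move=> /cvg_limn_inf_sup[].
by apply/funext => n; rewrite /b addrC subrK.
Qed.

(** Probability of visiting [s] at one of the times [0] to [n - 1] from [x]; a return to [s] within
    times [1] to [n] is one transition followed by this event. *)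
Fixpoint hit pi (s : S) n (x : S) : R :=
  if n is m.+1 then
    if x == s then 1 else avg (policy_kernel pi) (hit pi s m) x
  else 0.

Lemma expect_hit pi s past (mu : S -> R) n :
  expect_from M (policy_of pi) past mu
    (fun w : n.-tuple (S * A) => (s \in [seq q.1 | q <- w])%:R)
  = \sum_x mu x * hit pi s n x.
Proof.
elim: n past mu => [|n IH] past mu.
  by rewrite expect_from0 big1// => x _; rewrite mulr0.
rewrite expect_fromS; apply: eq_bigr => x _; congr (_ * _) => /=.
under eq_bigr do under eq_expect_from do rewrite /= in_cons eq_sym.
have [_|xs] := eqVneq x s.
  under eq_bigr do rewrite expect_from_cst mulr1.
  exact: distr_sum1.
by rewrite avg_policy_kernel; apply: eq_bigr => a _; rewrite IH.
Qed.

Lemma return_probE pi s :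
  return_prob M pi s = limn (fun n => avg (policy_kernel pi) (hit pi s n) s).
Proof.
congr (limn _); apply/funext => n.
rewrite expect_fromE expect_fromS sum_point_mass avg_policy_kernel.
by apply: eq_bigr => a _; rewrite expect_hit.
Qed.

Lemma hit_bounds pi s n x : 0 <= hit pi s n x <= 1.
Proof.
elim: n x => [|n IH] x; first by rewrite lexx ler01.
rewrite /=; case: ifP => _; first by rewrite ler01 lexx.
rewrite avg_ge0 => [|x']; last by case/andP: (IH x').
by rewrite -(avg_cst (policy_kernel pi) 1 x) ler_avg// => x'; case/andP: (IH x').
Qed.

Lemma hit_nondecreasing pi s x :
  {homo (fun n => hit pi s n x) : m n / (m <= n)%N >-> m <= n}.
Proof.
apply/nondecreasing_seqP => n; elim: n x => [|n IH] x.
  by case/andP: (hit_bounds pi s 1 x).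
by rewrite [leRHS]/= [leLHS]/=; case: ifP => // _; exact: ler_avg.
Qed.

(** The function [q] is the probability of ever visiting [s], the monotone limit of [hit]; it is
    harmonic away from [s]. *)
Lemma return_prob_hit pi s : exists q : S -> R,
  [/\ return_prob M pi s = avg (policy_kernel pi) q s,
      q s = 1,
      forall x, q x <= 1 &
      forall x, x != s -> q x = avg (policy_kernel pi) q x].
Proof.
pose q x := limn (fun n => hit pi s n x).
have qc x : (fun n => hit pi s n x) @ \oo --> q x.
  apply: nondecreasing_is_cvgn; first exact: hit_nondecreasing.
  by exists 1 => _ [n _ <-]; case/andP: (hit_bounds pi s n x).
have qS x : (fun n => hit pi s n.+1 x) @ \oo --> q x.
  by rewrite (cvg_shiftS (fun n => hit pi s n x)); exact: qc.
exists q; split.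
- rewrite return_probE.
  have qs : (fun n => avg (policy_kernel pi) (hit pi s n) s) @ \oo
      --> avg (policy_kernel pi) q s.
    by apply: cvg_avg; exact: qc.
  exact: (cvg_lim (@Rhausdorff R) qs).
- have := qS s; rewrite /= eqxx => qs.
  by apply: (cvg_unique (@Rhausdorff R) qs); exact: cvg_cst.
- move=> x; apply: limr_le; first exact: qc.
  by apply: nearW => n; case/andP: (hit_bounds pi s n x).
- move=> x /negPf xs; have := qS x; rewrite /= xs => qx.
  apply: (cvg_unique (@Rhausdorff R) qx).
  by apply: cvg_avg; exact: qc.
Qed.

End Stationary.

(** * Closed sets of states and a minimum principle *)

Section Closed.
Context {R : realType} {S : finType}.
Implicit Types (p : S -> distr R S) (C : {set S}).

Definition closed_under p C : bool :=
  [forall s in C, forall s', (p s s' != 0) ==> (s' \in C)].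

Lemma closed_underP p C :
  reflect (forall s s', s \in C -> p s s' != 0 -> s' \in C) (closed_under p C).
Proof.
apply: (iffP forall_inP) => [cl s s' sC|cl s sC].
  by have /forallP/(_ s')/implyP := cl s sC.
by apply/forallP => s'; apply/implyP; exact: cl.
Qed.

(** The terms [p s y * (f y - m)] are nonnegative with sum at most 0, so all of them vanish. *)
Lemma avg_le_min p (f : S -> R) s m :
  (forall x, p s x != 0 -> m <= f x) -> avg p f s <= m ->
  forall x, p s x != 0 -> f x = m.
Proof.
move=> mf fm x px.
have t0 y : 0 <= p s y * (f y - m).
  have [->|py] := eqVneq (p s y) 0; first by rewrite mul0r.
  by rewrite mulr_ge0 ?distr_ge0// subr_ge0 mf.
have : \sum_y p s y * (f y - m) = 0.
  apply: le_anti; rewrite sumr_ge0// andbT.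
  by have := avgB p f (fun=> m) s; rewrite avg_cst /avg => ->; rewrite subr_le0.
move/(psumr_eq0P (fun y _ => t0 y))/(_ x isT)/eqP.
by rewrite mulf_eq0 (negPf px) subr_eq0 => /eqP.
Qed.

(** The minimum principle for superharmonic functions, applied below to hitting probabilities, to
    the gain, and to its opposite. *)
Lemma closed_argmin p (f : S -> R) C m : closed_under p C ->
  (forall x, x \in C -> m <= f x) ->
  (forall x, x \in C -> f x = m -> avg p f x <= m) ->
  closed_under p [set x in C | f x == m].
Proof.
move=> /closed_underP clC mf avgm; apply/closed_underP => s s'.
rewrite !inE => /andP[sC /eqP fs] pss'; rewrite (clC s)//=; apply/eqP.
apply: (@avg_le_min p f s) pss'; last exact: avgm.
by move=> x px; apply: mf; exact: clC px.
Qed.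

End Closed.

(** * Recurrent states in closed sets and constancy of the optimal gain *)

Section GainConstant.
Context {R : realType} {S A : finType}.
Variable M : mdp R S A.
Implicit Types (pi : stationary_policy R S A) (C : {set S}).

(* In a minimal closed set, the probability of ever hitting [s] attains its
   minimum on a closed set unless this minimum is 1. *)
Lemma closed_recurrent pi C :
  C != finset.set0 -> closed_under (policy_kernel M pi) C ->
  exists2 s, s \in C & ~ transient M pi s.
Proof.
move=> C0 clC.
have [D /minsetP[/andP[/set0Pn[s sD] clD] minD] DC] :
    {D | minset (fun D => (D != finset.set0)
           && closed_under (policy_kernel M pi) D) D & D \subset C}.
  by apply: minset_exists; rewrite C0.
exists s; first exact: (fintype.subsetP DC).
have [q [rE qs q1 qE]] := return_prob_hit M pi s.
rewrite /transient rE => lt1.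
have [x0 x0D minq] : exists2 x0, x0 \in D & forall x, x \in D -> q x0 <= q x.
  by case: (arg_minP q sD) => x0 x0D minq; exists x0.
(* If the minimum is 1, every successor of [s] returns to [s] surely, against [lt1]. *)
have [q1x|q1x] := eqVneq (q x0) 1.
  suff : avg (policy_kernel M pi) q s = 1.
    by move=> qs1; move: lt1; rewrite qs1 ltxx.
  rewrite -(avg_cst (policy_kernel M pi) 1 s); apply: eq_bigr => x _.
  have [->|px] := eqVneq (policy_kernel M pi s x) 0; first by rewrite !mul0r.
  congr (_ * _); apply: le_anti; rewrite q1 -q1x minq//.
  by have /closed_underP := clD; apply; first exact: sD.
(* Otherwise no minimizer is [s], where [q] is 1, so [q] is harmonic at each minimizer. Minimality
   of [D] then puts [s] among the minimizers, a contradiction. *)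
have clE : closed_under (policy_kernel M pi) [set x in D | q x == q x0].
  apply: closed_argmin => // x xD qx; rewrite -qE ?qx//.
  by apply: contraNneq q1x => xs; rewrite -qx xs qs.
have := minD [set x in D | q x == q x0].
rewrite clE andbT => /(_ _ _)/setP/(_ s); rewrite inE sD /= qs => H.
move: q1x; rewrite eq_sym H ?negbK//.
  by apply/set0Pn; exists x0; rewrite inE x0D eqxx.
by apply/fintype.subsetP => x; rewrite inE => /andP[].
Qed.

(** A trajectory of nonzero probability uses only transitions of nonzero probability, and these stay
    in [C]. *)
Lemma traj_prob_closed (pol : policy R S A) C past (mu : S -> R) w :
  (forall a, closed_under (trans M ^~ a) C) ->
  (forall s, mu s != 0 -> s \in C) ->
  traj_prob_from M pol past mu w != 0 ->
  forall s, s \in [seq q.1 | q <- w] -> s \in C.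
Proof.
move=> clC; elim: w past mu => [//|[s a] w IH] past mu muC /=.
rewrite !mulf_eq0 !negb_or => /andP[/andP[mus _] w0] s'.
rewrite in_cons => /predU1P[->|]; first exact: muC.
apply: (IH _ _ _ w0) => x px.
by have /closed_underP := clC a; apply; first exact: (muC s).
Qed.

Lemma leads_to_closed (pol : policy R S A) C s1 s2 :
  (forall a, closed_under (trans M ^~ a) C) -> s1 \in C ->
  leads_to M pol s1 s2 -> s2 \in C.
Proof.
move=> clC s1C [n]; apply: contraTT => s2C; rewrite -leNgt.
rewrite /expect; apply: sumr_le0 => w _.
have [->|w0] := eqVneq (traj_prob M pol s1 w) 0; first by rewrite mul0r.
have [s2w|_] := boolP (s2 \in _); last by rewrite mulr0.
case/negP: s2C; apply: (traj_prob_closed clC _ w0 s2w) => s.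
by rewrite pnatr_eq0 eqb0 negbK => /eqP ->.
Qed.

Lemma closed_under_policy pi C :
  (forall a, closed_under (trans M ^~ a) C) ->
  closed_under (policy_kernel M pi) C.
Proof.
move=> clC; apply/closed_underP => s s' sC; apply: contraNT => s'C /=.
rewrite big1// => a _; apply/eqP; rewrite mulf_eq0; apply/orP; right.
apply: contraNT s'C => pss'; have /closed_underP := clC a.
by apply; first exact: sC.
Qed.

(** Some policy leads from a minimizing state outside [N] to a maximizing one outside [N], yet no
    policy leaves the minimizing set, so minimum and maximum agree. *)
Lemma gain_optimal_constant pi : weakly_communicating M -> gain_optimal M pi ->
  forall s s', gain M pi s = gain M pi s'.
Proof.
move=> [N [Ntrans Ncomm]] piopt s0.
set rho := gain M pi.
have meetsN C : C != finset.set0 -> closed_under (policy_kernel M pi) C ->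
    exists2 s, s \in C & s \notin N.
  move=> C0 clC; have [s sC rec] := closed_recurrent C0 clC.
  by exists s => //; apply/negP => /Ntrans /(_ pi).
have [smin minrho] : exists smin, forall s, rho smin <= rho s.
  case: (@arg_minP _ _ _ s0 xpredT rho isT) => x _ xmin.
  by exists x => s; exact: xmin.
have [smax maxrho] : exists smax, forall s, rho s <= rho smax.
  case: (@arg_maxP _ _ _ s0 xpredT rho isT) => x _ xmax.
  by exists x => s; exact: xmax.
(* Both sets have the shape required by [closed_argmin]; for the maximum this means minimizing
   [- rho]. *)
pose Kmin := [set s in [set: S] | rho s == rho smin].
pose Kmax := [set s in [set: S] | - rho s == - rho smax].
have clT p : closed_under p ([set: S] : {set S}).
  by apply/closed_underP => *; rewrite inE.
(* Optimality of [pi] bounds the gain expected after any action by [rho x]. *)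
have clmin a : closed_under (trans M ^~ a) Kmin.
  apply: closed_argmin => // x _ <-.
  by rewrite [leRHS]piopt; exact: avg_gain_le_opt.
(* Here only the kernel of [pi] is available, as [rho] is invariant under it. *)
have clmax : closed_under (policy_kernel M pi) Kmax.
  apply: closed_argmin => // [x _|x _ <-]; first by rewrite lerN2.
  by rewrite avgN avg_gain.
have [s1 s1K s1N] : exists2 s, s \in Kmin & s \notin N.
  apply: meetsN; last exact: closed_under_policy.
  by apply/set0Pn; exists smin; rewrite !inE eqxx.
have [s2 s2K s2N] : exists2 s, s \in Kmax & s \notin N.
  by apply: meetsN => //; apply/set0Pn; exists smax; rewrite !inE eqxx.
have [pol /(leads_to_closed clmin s1K)] := Ncomm s1 s2 s1N s2N.
move: s2K; rewrite !inE /= eqr_opp => /eqP -> /eqP mm s.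
by apply: le_anti; apply/andP; split; apply: le_trans (maxrho _) _; rewrite mm.
Qed.

End GainConstant.

(** * Comparison of gain and discounted value *)

Section Reduction.
Local Open Scope classical_set_scope.
Context {R : realType} {S A : finType}.
Variable M : mdp R S A.
Implicit Types (pi : stationary_policy R S A).

Lemma ler_sp (f : S -> R) x y : f x - f y <= sp f.
Proof.
pose C := \sum_x `|f x|.
have fC z : `|f z| <= C := ler_sum_norm f z.
apply: lerB.
  apply: ub_le_sup; last by exists x.
  by exists C => _ [z _ <-]; exact: le_trans (ler_norm _) (fC z).
apply: ge_inf; last by exists y.
by exists (- C) => _ [z _ <-]; have := fC z; rewrite ler_norml => /andP[].
Qed.

(* Averaging [mean_reward = (1 - g) V + g (V - P V)] along the chain, the
   second part telescopes. *)
Lemma gain_ge_disc_value pi (g c : R) : 0 <= g < 1 ->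
  (forall s, c <= (1 - g) * disc_value M (policy_of pi) g s) ->
  forall s, c <= gain M pi s.
Proof.
move=> g01 cV; have [z [gP rE]] := gain_decomp M pi.
set V := disc_value M (policy_of pi) g in cV.
have lb n s : n%:R * c + g * (V s - iter n (avg (policy_kernel M pi)) V s)
    <= value M (policy_of pi) n s.
  rewrite value_stationary; elim: n s => [|n IH] s.
    by rewrite /= mul0r add0r subrr mulr0.
  rewrite [leRHS]/= mul1r.
  have /(ler_avg (policy_kernel M pi) s) := IH.
  rewrite avgD avg_cst avgZ avgB iterS.
  (* Together these give [c + g (V - P V) <= r] at [s], the increment needed for one more step. *)
  have := cV s; have := disc_value_fixpoint M pi s g01; rewrite -/V.
  move: (avg _ V s) (avg _ (iter _ _ _) s) (avg _ (accum _ _ _ _) s).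
  move: (mean_reward _ _ _) => a b d e.
  by rewrite -natr1; lra.
move=> s; pose C := \sum_x `|V x|.
have bC n : `|g * (V s - iter n (avg (policy_kernel M pi)) V s)| <= g * (C + C).
  have /andP[g0 _] := g01; rewrite normrM (ger0_norm g0) ler_wpM2l//.
  rewrite (le_trans (ler_normB _ _))// lerD ?ler_sum_norm//.
  by apply: iter_avg_norm_le => x; exact: ler_sum_norm.
have vc : (fun n => n%:R^-1 * value M (policy_of pi) n s) @ \oo --> gain M pi s.
  under eq_fun do rewrite value_stationary.
  exact: (cvg_accum_mean gP rE (s:=s)).
have bc := cvg_bounded_affine_div bC (y:=c).
apply: (ler_cvg_to bc vc).
by apply: nearW => n; rewrite ler_wpM2l ?invr_ge0.
Qed.

(** Minimum principle for [V - h]: at a minimizer [x], the equations for [V] and [h] give [(1 - g)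
    (V x - h x) >= rho - (1 - g) (P h) x]. Then [V s >= h s + (V x - h x)] and [(P h) x <= h m]
    leave only the difference [h m - h s]. *)
Lemma disc_value_ge_gain pi g rho : 0 <= g < 1 ->
  (forall s, gain M pi s = rho) ->
  forall s, rho - (1 - g) * sp (bias M pi)
    <= (1 - g) * disc_value M (policy_of pi) g s.
Proof.
move=> g01 rhoE s; have /andP[g0 g1] := g01.
set V := disc_value M (policy_of pi) g; set h := bias M pi.
have [x minx] : exists x, forall y, V x - h x <= V y - h y.
  case: (@arg_minP _ _ _ s xpredT (fun y => V y - h y) isT) => x _ xmin.
  by exists x => y; exact: xmin.
have [m maxm] : exists m, forall y, h y <= h m.
  case: (@arg_maxP _ _ _ s xpredT h isT) => m _ mmax.
  by exists m => y; exact: mmax.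
have := disc_value_fixpoint M pi x g01; have := bias_equation M pi x.
rewrite rhoE -/V -/h => hE VE.
have : avg (policy_kernel M pi) (fun y => h y + (V x - h x)) x
    <= avg (policy_kernel M pi) V x.
  by apply: ler_avg => y; rewrite addrC -lerBrDr minx.
have : avg (policy_kernel M pi) h x <= avg (policy_kernel M pi) (fun=> h m) x.
  exact: ler_avg.
rewrite avgD !avg_cst.
move: hE VE; move: (avg _ h x) (avg _ V x) (mean_reward _ _ _) => a b d.
move=> hE VE am /(ler_wpM2l g0) abV.
have {hE VE abV} ge_a : rho - (1 - g) * a <= (1 - g) * (V x - h x).
  by clear - hE VE abV; lra.
have g1_ge0 : 0 <= 1 - g by rewrite subr_ge0 ltW.
rewrite lerBlDr -mulrDr (le_trans (y := (1 - g) * (V x - h x + a)))//.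
  by rewrite mulrDr -lerBlDr.
rewrite ler_wpM2l// (le_trans (lerD (minx s) am))//.
by rewrite addrAC -addrA lerD2l ler_sp.
Qed.

End Reduction.

(** * The gain bound for policies nearly optimal in the discounted problem *)

Theorem theorem1 (R : realType) (S A : finType) (M : mdp R S A)
  (wcM : weakly_communicating M)
  (pistar : stationary_policy R S A) (pistar_opt : gain_optimal M pistar)
  (H : R) (HE : H = sp (bias M pistar)) (H_ge1 : 1 <= H)
  (eps : R) (eps_gt0 : 0 < eps) (eps_le1 : eps <= 1)
  (gamma : R) (gammaE : gamma = 1 - eps / H)
  (eps_gamma : R) (eps_gamma_ge0 : 0 <= eps_gamma)
  (eps_gamma_le : eps_gamma <= (1 - gamma)^-1)
  (pi : stationary_policy R S A)
  (pi_opt : disc_optimal_within M gamma eps_gamma pi) :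
  (forall s : S,
     opt_gain M s - gain M pi s <= 8 * eps + 3 * (1 - gamma) * eps_gamma) /\
  8 * eps + 3 * (1 - gamma) * eps_gamma = (8 + 3 * (eps_gamma / H)) * eps.
Proof.
have H0 : 0 < H by rewrite (lt_le_trans ltr01).
have g1E : 1 - gamma = eps / H by rewrite gammaE; ring.
split; last by rewrite g1E; field; rewrite gt_eqF.
(* Nonnegativity comes from [eps <= 1 <= H], strictness from [eps > 0]. *)
have g01 : 0 <= gamma < 1.
  rewrite -[gamma < 1]subr_gt0 g1E divr_gt0// andbT gammaE subr_ge0.
  by rewrite ler_pdivrMr// mul1r (le_trans eps_le1).
have epsE : (1 - gamma) * H = eps by rewrite g1E divfK// gt_eqF.
have g1_ge0 : 0 <= 1 - gamma by rewrite subr_ge0 ltW//; case/andP: g01.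
move=> s; rewrite -pistar_opt; set rho := gain M pistar s.
(* A bound with constants 1 and 1 in place of 8 and 3; the difference is nonnegative. *)
suff : rho - eps - (1 - gamma) * eps_gamma <= gain M pi s.
  by have : 0 <= (1 - gamma) * eps_gamma by [rewrite mulr_ge0|]; lra.
apply: (gain_ge_disc_value g01) => x.
have := disc_value_ge_gain g01
  (gain_optimal_constant wcM pistar_opt ^~ s : forall y, gain M pistar y = rho) x.
rewrite -HE epsE.
(* The discounted value of [pistar] is at most the optimal one, which [pi] misses by at most
   [eps_gamma]. *)
have : disc_value M (policy_of pistar) gamma x - eps_gamma
    <= disc_value M (policy_of pi) gamma x.
  have := disc_value_le_opt M (policy_of pistar) x g01.
  have : opt_disc_value M gamma x - disc_value M (policy_of pi) gamma x
      <= eps_gamma.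
    apply: le_trans (ler_norm _) (le_trans _ pi_opt).
    exact: (le_bigmax _ (fun y => `|opt_disc_value M gamma y
      - disc_value M (policy_of pi) gamma y|)).
  lra.
move=> /(ler_wpM2l g1_ge0); rewrite mulrBr; lra.
Qed.
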